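(* Let $\kappa$ and $\lambda$ be cardinals of uncountable cofinality and let $$\mathcal{I}=\ell^{\infty}_{\kappa}(\kappa^{+},\ell^{\infty}(\lambda^{+}))+\ell^{\infty}(\kappa^{+},\ell^{\infty}_{\lambda}(\lambda^{+}))\subset\ell^{\infty}(\kappa^{+},\ell^{\infty}(\lambda^{+})).$$ Then the Banach algebra $\ell^{\infty}(\kappa^{+},\ell^{\infty}(\lambda^{+}))/\mathcal{I}$ is convex-transitive.
   Context: All Banach spaces are real. For a cardinal $\mu$ and a Banach space $X$, $\ell^\infty(\mu,X)$ is the space of bounded families $(x_\alpha)_{\alpha<\mu}$ in $X$ with the sup norm, and $\ell^\infty(\mu)=\ell^\infty(\mu,\mathbb{R})$. For infinite cardinals $\sigma\leq\mu$, $\ell^{\infty}_{\sigma}(\mu,X)=\{x=(x_\alpha)_{\alpha<\mu}\in\ell^{\infty}(\mu,X):\ |\mathrm{supp}(x)|\leq\sigma\}$, where $\mathrm{supp}(x)=\{\alpha: x_\alpha\neq0\}$, and $\ell^\infty_\sigma(\mu)=\ell^\infty_\sigma(\mu,\mathbb{R})$. $\kappa^+$ is the successor cardinal of $\kappa$. The algebra $\ell^{\infty}(\kappa^{+},\ell^{\infty}(\lambda^{+}))$ has pointwise multiplication, $\mathcal{I}$ is a closed ideal of it, and the quotient carries the quotient norm. A Banach space $X$ is convex-transitive if for every $x$ in its unit sphere, $\overline{\mathrm{conv}}\{T(x): T\in\mathcal{G}_X\}$ equals the closed unit ball of $X$, where $\mathcal{G}_X$ is the group of isometric (linear, surjective)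 automorphisms of $X$. *)

(* Defs.v *)
From HB Require Import structures.
From mathcomp Require Import all_boot all_order all_algebra.
From mathcomp Require Import all_classical all_reals all_analysis.
From mathcomp Require Import wochoice generic_quotient ring_quotient.

Set Implicit Arguments.
Unset Strict Implicit.
Unset Printing Implicit Defensive.

Import Order.TTheory GRing.Theory Num.Theory.
Import numFieldNormedType.Exports.

Local Open Scope classical_set_scope.
Local Open Scope ring_scope.
Local Open Scope card_scope.
Local Open Scope quotient_scope.

(* A cardinal is an initial ordinal: a well-ordered type not equipotent to any
   of its proper initial segments. *)
Record cardinal := Cardinal {
  cardinal_sort :> Type;
  cardinal_le : rel cardinal_sort;
  cardinal_wo : well_order cardinal_le;
  cardinal_initial : forall x : cardinal_sort,
    ~ ([set: cardinal_sort] #<= [set y | cardinal_le y x /\ y <> x]) }.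

Definition cardinal_lt (K M : cardinal) : Prop :=
  [set: K] #<= [set: M] /\ ~ ([set: M] #<= [set: K]).

Definition is_successor (K Kp : cardinal) : Prop :=
  cardinal_lt K Kp /\
  forall M : cardinal, cardinal_lt K M -> [set: Kp] #<= [set: M].

Definition cofinal (K : cardinal) (A : set K) : Prop :=
  forall x : K, exists2 y, A y & cardinal_le x y.

(* The cofinality is the least cardinality of a cofinal subset.  A finite
   cardinal has a finite cofinal subset (a maximum, or the empty set when the
   cardinal is 0), so this condition forces K to be infinite. *)
Definition uncountable_cofinality (K : cardinal) : Prop :=
  forall A : set K, cofinal A -> ~ countable A.

Lemma card_le_typeP {T U : Type} (u0 : U) (A : set T) :
  A #<= [set: U] <-> exists f : T -> U, {in A &, injective f}.
Proof.
pose U' : pointedType := HB.pack U (gen_eqMixin U) (gen_choiceMixin U)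
  (isPointed.Build U u0).
by split=> /(@pcard_injP T U' A).
Qed.

Section UncountableCofinality.
Variables (K : cardinal) (hK : uncountable_cofinality K).
Local Notation le := (@cardinal_le K).

Lemma uncof_inhabited : exists x : K, True.
Proof.
apply: contrapT => nK; apply: (hK (A := set0)); last exact: countable0.
by move=> x; case: nK; exists x.
Qed.

Lemma cardinal_min (A : set K) : A !=set0 ->
  exists2 x, A x & forall y, A y -> le x y.
Proof.
move=> [a Aa]; have [|x [[Ax xA] _]] := @cardinal_wo K (mem A).
  by exists a; exact/mem_set.
by exists x => [|y Ay]; [exact/set_mem|exact/xA/mem_set].
Qed.

Lemma cardinal_le_anti (x y : K) : le x y -> le y x -> x = y.
Proof.
move=> xy yx; have [|z [_ uz]] := @cardinal_wo K (mem [set x; y]).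
  by exists x; apply/mem_set; left.
have refl t : le t t.
  have [|m ->] := @cardinal_min [set t]; first by exists t.
  by apply.
transitivity z; [apply/esym|]; apply: uz; split;
  try by [apply/mem_set; left|apply/mem_set; right].
  by move=> t /set_mem[->|->].
by move=> t /set_mem[->|->].
Qed.

Lemma uncof_succ : exists s : K -> K,
  (forall x, ~ le (s x) x) /\ (forall x y, ~ le y x -> le (s x) y).
Proof.
have [s sP] : {s : K -> K & forall x, ~ le (s x) x /\
    forall y, ~ le y x -> le (s x) y}.
  apply: (@choice _ _ (fun x z => ~ le z x /\
    forall y, ~ le y x -> le z y)) => x.
  have [|y ? yP] := @cardinal_min [set y | ~ le y x].
    apply: contrapT => nx; apply: (hK (A := [set x])); last exact: countable1.
    move=> y; exists x => //; apply: contrapT => nyx; apply: nx.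
    by exists y.
  by exists y.
by exists s; split=> x; have [] := sP x.
Qed.

Lemma uncof_prod_nat : exists f : K * nat -> K, injective f.
Proof.
have [s [s_gt s_min]] := uncof_succ.
have s_inj : injective s.
  have aux x y : s x = s y -> le y x.
    move=> sxy; apply: contrapT => /s_min; rewrite sxy; exact: s_gt.
  by move=> x y sxy; apply: cardinal_le_anti; apply: aux.
pose limit l := forall z, s z <> l.
have dec x : exists ln : K * nat, limit ln.1 /\ iter ln.2 s ln.1 = x.
  apply: contrapT => nx.
  have [|m nm mmin] := @cardinal_min
    [set x | ~ exists ln : K * nat, limit ln.1 /\ iter ln.2 s ln.1 = x].
    by exists x.
  apply: nm; have [lm|/existsNP[z /contrapT szm]] := pselect (limit m).
    by exists (m, 0%N).
  have [[ln [? lnz]]|nz] := pselect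
      (exists ln : K * nat, limit ln.1 /\ iter ln.2 s ln.1 = z).
    by exists (ln.1, ln.2.+1); split => //=; rewrite lnz.
  by case: (s_gt z); rewrite szm; exact: mmin.
have [g gP] := choice dec.
have iter_inj n m l l' : limit l -> limit l' ->
    iter n s l = iter m s l' -> n = m /\ l = l'.
  move=> ll ll'; elim: n m => [|n IHn] [|m] //=.
  - by move=> /esym/ll.
  - by move=> /ll'.
  - by move=> /s_inj/IHn[-> ->].
exists (fun xn => iter (pickle ((g xn.1).2, xn.2)) s (g xn.1).1).
move=> [x n] [y m] /= e.
have [[lx _] [ly _]] := (gP x, gP y).
have [/(pcan_inj pickleK)[e2 ->] e1] := iter_inj _ _ _ _ lx ly e; congr pair.
by have [_ <-] := gP x; have [_ <-] := gP y; rewrite e1 e2.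
Qed.

Lemma uncof_bigcup (T : Type) (F : nat -> set T) :
  (forall n, F n #<= [set: K]) -> \bigcup_n F n #<= [set: K].
Proof.
move=> FK; have [k0 _] := uncof_inhabited.
have [f fP] : {f : nat -> T -> K & forall n, {in F n &, injective (f n)}}.
  apply: (@choice _ _ (fun n f => {in F n &, injective f})) => n.
  by apply/(card_le_typeP k0).
have [g gP] : {g : T -> nat & forall x, (\bigcup_n F n) x -> F (g x) x}.
  apply: (@choice _ _ (fun x n => (\bigcup_n F n) x -> F n x)) => x.
  have [[n _ Fnx]|nx] := pselect ((\bigcup_n F n) x).
    by exists n.
  by exists 0%N.
have [p p_inj] := uncof_prod_nat.
apply/(card_le_typeP k0); exists (fun x => p (f (g x) x, g x)) => x y.
move=> /set_mem/gP Fx /set_mem/gP Fy /p_inj[+ gxy].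
by rewrite gxy in Fx * => /fP; apply; exact/mem_set.
Qed.

Lemma uncof_setU (T : Type) (A B : set T) :
  A #<= [set: K] -> B #<= [set: K] -> A `|` B #<= [set: K].
Proof.
move=> AK BK; apply: (@card_le_trans _ _ _
    (\bigcup_n (if n is 0%N then A else B))).
  apply: subset_card_le => x [?|?]; first by exists 0%N.
  by exists 1%N.
by apply: uncof_bigcup => -[].
Qed.

End UncountableCofinality.

(* Sums and scalar multiples are locked to keep unification from unfolding the
   instances when these spaces are nested; use linfDE, linfZE, etc. *)
Fact linf_key : unit. Proof. exact: tt. Qed.

Section Linf.
Context {R : realType}.
Variables (I : Type) (X : normedModType R).

Definition bounded_family (f : I -> X) : Prop :=
  has_ubound (range (fun i => `|f i|)).

Record linf := Linf {
  linf_val :> I -> X;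
  linf_valP : `[< bounded_family linf_val >] }.

HB.instance Definition _ := [isSub for linf_val].
HB.instance Definition _ := [Choice of linf by <:].

Lemma linf_ext (x y : linf) : (forall i, x i = y i) -> x = y.
Proof. by move=> xy; apply: val_inj; apply/funext. Qed.

Definition linf_mk (f : I -> X) (fb : bounded_family f) : linf :=
  locked_with linf_key (Linf (asboolT fb)).

Lemma linf_mkE f fb i : @linf_mk f fb i = f i.
Proof. by rewrite /linf_mk unlock. Qed.

Lemma linf_bounded (x : linf) : bounded_family x.
Proof. exact/asboolP/linf_valP. Qed.

Lemma bounded_familyP (f : I -> X) :
  (exists M : R, forall i, `|f i| <= M) -> bounded_family f.
Proof. by move=> [M fM]; exists M => _ [i _ <-]. Qed.

Lemma linf_bound (x : linf) : exists M : R, forall i, `|x i| <= M.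
Proof.
by have [M xM] := linf_bounded x; exists M => i; apply: xM; exists i.
Qed.

Lemma bounded_family0 : bounded_family (fun=> 0).
Proof. by apply: bounded_familyP; exists 0 => i; rewrite normr0. Qed.

Lemma bounded_familyN (x : linf) : bounded_family (fun i => - x i).
Proof.
apply: bounded_familyP; have [M xM] := linf_bound x.
by exists M => i; rewrite normrN.
Qed.

Lemma bounded_familyD (x y : linf) : bounded_family (fun i => x i + y i).
Proof.
apply: bounded_familyP; have [M xM] := linf_bound x.
have [N yN] := linf_bound y; exists (M + N) => i.
by rewrite (le_trans (ler_normD _ _))// lerD.
Qed.

Lemma bounded_familyZ (a : R) (x : linf) : bounded_family (fun i => a *: x i).
Proof.
apply: bounded_familyP; have [M xM] := linf_bound x.
by exists (`|a| * M) => i; rewrite normrZ ler_wpM2l.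
Qed.

Definition linf_zero : linf := linf_mk bounded_family0.
Definition linf_opp (x : linf) : linf := linf_mk (bounded_familyN x).
Definition linf_add (x y : linf) : linf := linf_mk (bounded_familyD x y).
Definition linf_scale (a : R) (x : linf) : linf :=
  linf_mk (bounded_familyZ a x).

Lemma linf_addA : associative linf_add.
Proof. by move=> x y z; apply: linf_ext => i; rewrite !linf_mkE addrA. Qed.

Lemma linf_addC : commutative linf_add.
Proof. by move=> x y; apply: linf_ext => i; rewrite !linf_mkE addrC. Qed.

Lemma linf_add0 : left_id linf_zero linf_add.
Proof. by move=> x; apply: linf_ext => i; rewrite !linf_mkE add0r. Qed.

Lemma linf_addN : left_inverse linf_zero linf_opp linf_add.
Proof. by move=> x; apply: linf_ext => i; rewrite !linf_mkE addNr. Qed.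

HB.instance Definition _ :=
  GRing.isZmodule.Build linf linf_addA linf_addC linf_add0 linf_addN.

Lemma linf_scalerA a b x :
  linf_scale a (linf_scale b x) = linf_scale (a * b) x.
Proof. by apply: linf_ext => i; rewrite !linf_mkE scalerA. Qed.

Lemma linf_scale1r : left_id 1 linf_scale.
Proof. by move=> x; apply: linf_ext => i; rewrite !linf_mkE scale1r. Qed.

Lemma linf_scalerDr : right_distributive linf_scale +%R.
Proof. by move=> a x y; apply: linf_ext => i; rewrite !linf_mkE scalerDr. Qed.

Lemma linf_scalerDl x : {morph linf_scale^~ x : a b / a + b}.
Proof. by move=> a b; apply: linf_ext => i; rewrite !linf_mkE scalerDl. Qed.

HB.instance Definition _ := GRing.Zmodule_isLmodule.Build R linf
  linf_scalerA linf_scale1r linf_scalerDr linf_scalerDl.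

(* [sup set0 = 0], so the formula is also right for an empty index type. *)
Definition linf_norm (x : linf) : R := sup (range (fun i => `|x i|)).

Lemma linf_norm_ub (x : linf) i : `|x i| <= linf_norm x.
Proof. by apply: ub_le_sup; [exact: linf_bounded|exists i]. Qed.

Lemma linf_norm_ge0 x : 0 <= linf_norm x.
Proof.
have [[i _]|nI] := pselect (exists i : I, True).
  by apply: le_trans (linf_norm_ub x i).
rewrite /linf_norm (_ : (fun i => `|x i|) @` setT = set0) ?sup0//.
by apply/seteqP; split=> // r [i _ _]; apply: nI; exists i.
Qed.

Lemma linf_norm_le (x : linf) M :
  0 <= M -> (forall i, `|x i| <= M) -> linf_norm x <= M.
Proof.
move=> M0 xM; have [[i _]|nI] := pselect (exists i : I, True).
  apply: ge_sup => [|_ [j _ <-]]//.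
  by exists `|x i|, i.
rewrite /linf_norm (_ : (fun i => `|x i|) @` setT = set0) ?sup0//.
by apply/seteqP; split=> // r [i _ _]; apply: nI; exists i.
Qed.

Lemma linf_normD x y : linf_norm (x + y) <= linf_norm x + linf_norm y.
Proof.
apply: linf_norm_le => [|i]; first by rewrite addr_ge0// linf_norm_ge0.
by rewrite linf_mkE (le_trans (ler_normD _ _))// lerD// linf_norm_ub.
Qed.

Lemma linf_normZ (l : R) x : linf_norm (l *: x) = `|l| * linf_norm x.
Proof.
have le (k : R) y : linf_norm (k *: y) <= `|k| * linf_norm y.
  apply: linf_norm_le => [|i]; first by rewrite mulr_ge0// linf_norm_ge0.
  by rewrite linf_mkE normrZ ler_wpM2l// linf_norm_ub.
apply/eqP; rewrite eq_le le/=; have [->|l0] := eqVneq l 0.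
  by rewrite normr0 mul0r linf_norm_ge0.
rewrite -ler_pdivlMl ?normr_gt0// -normfV.
by apply: le_trans (le _ _); rewrite scalerA mulVf// scale1r.
Qed.

Lemma linf_norm0_eq0 x : linf_norm x = 0 -> x = 0.
Proof.
move=> x0; apply: linf_ext => i; rewrite linf_mkE; apply/normr0_eq0/eqP.
by rewrite eq_le normr_ge0 andbT -x0 linf_norm_ub.
Qed.

HB.instance Definition _ := Lmodule_isNormed.Build R linf
  linf_normD linf_normZ linf_norm0_eq0.

Definition linf_space : normedModType R := NormedModule.clone R linf _.

Lemma linf0E i : (0 : linf_space) i = 0.
Proof. exact: linf_mkE. Qed.

Lemma linfDE (x y : linf_space) i : (x + y) i = x i + y i.
Proof. exact: linf_mkE. Qed.

Lemma linfNE (x : linf_space) i : (- x) i = - x i.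
Proof. exact: linf_mkE. Qed.

Lemma linfBE (x y : linf_space) i : (x - y) i = x i - y i.
Proof. by rewrite linfDE linfNE. Qed.

Lemma linfZE a (x : linf_space) i : (a *: x) i = a *: x i.
Proof. exact: linf_mkE. Qed.

Lemma linf_coord_le (x : linf_space) i : `|x i| <= `|x|.
Proof. exact: linf_norm_ub. Qed.

End Linf.
Arguments linf {R} I X.
Arguments linf_space {R} I X.

Section Quotient.
Context {R : realType}.

Record closed_subspace (V : normedModType R) := ClosedSubspace {
  subspace_set :> set V;
  subspace_linear : submod_closed (mem subspace_set);
  subspace_closed : closed subspace_set }.

Variables (V : normedModType R) (W : closed_subspace V).

Definition subspace_pred : {pred V} := mem (W : set V).

HB.instance Definition _ :=
  GRing.isSubmodClosed.Build R V subspace_pred (subspace_linear W).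

Definition nquot := Quotient.quot subspace_pred.

HB.instance Definition _ := GRing.Zmodule.on nquot.
HB.instance Definition _ := EqQuotient.on nquot.

Lemma nquotP (u v : V) : (\pi_nquot u = \pi_nquot v) <->
  subspace_set W (u - v).
Proof.
split=> [/eqP|Wuv]; last apply/eqP.
  by rewrite -Quotient.idealrBE => /set_mem.
by rewrite -Quotient.idealrBE; apply/mem_set.
Qed.

Lemma nquot_piD (u v : V) : \pi_nquot (u + v) = \pi_nquot u + \pi_nquot v.
Proof. exact: (Quotient.pi_add subspace_pred). Qed.

Definition nquot_scale (a : R) (q : nquot) : nquot := \pi_nquot (a *: repr q).

Lemma nquot_piZ a (v : V) : nquot_scale a (\pi_nquot v) = \pi_nquot (a *: v).
Proof.
apply/nquotP; rewrite -scalerBr; apply/set_mem.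
apply: (rpredZ (s := subspace_pred)); apply/mem_set/nquotP.
exact: reprK.
Qed.

Lemma nquot_piW (P : nquot -> Prop) :
  (forall v, P (\pi_nquot v)) -> forall q, P q.
Proof. by move=> Ppi q; rewrite -[q]reprK. Qed.

Lemma nquot_scalerA a b q :
  nquot_scale a (nquot_scale b q) = nquot_scale (a * b) q.
Proof. by elim/nquot_piW: q => v; rewrite !nquot_piZ scalerA. Qed.

Lemma nquot_scale1r : left_id 1 nquot_scale.
Proof. by elim/nquot_piW => v; rewrite nquot_piZ scale1r. Qed.

Lemma nquot_scalerDr : right_distributive nquot_scale +%R.
Proof.
move=> a; elim/nquot_piW => u; elim/nquot_piW => v.
by rewrite -nquot_piD !nquot_piZ scalerDr nquot_piD.
Qed.

Lemma nquot_scalerDl q : {morph nquot_scale^~ q : a b / a + b}.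
Proof.
move=> a b; elim/nquot_piW: q => v.
by rewrite !nquot_piZ scalerDl nquot_piD.
Qed.

HB.instance Definition _ := GRing.Zmodule_isLmodule.Build R nquot
  nquot_scalerA nquot_scale1r nquot_scalerDr nquot_scalerDl.

Definition nquot_norm (q : nquot) : R :=
  inf [set `|v| | v in [set v : V | \pi_nquot v = q]].

Lemma nquot_norm_pi v : nquot_norm (\pi_nquot v) <= `|v|.
Proof.
apply: ge_inf; last by exists v.
by exists 0 => _ [w _ <-].
Qed.

Lemma nquot_norm_adherent q e : 0 < e ->
  exists2 v, \pi_nquot v = q & `|v| < nquot_norm q + e.
Proof.
move=> e0; have [|_ [v vq <-] ve] := @inf_adherent R
  [set `|v| | v in [set v : V | \pi_nquot v = q]] e e0; last by exists v.
split; last by exists 0 => _ [w _ <-].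
by exists `|repr q|, (repr q) => //=; rewrite reprK.
Qed.

Lemma nquot_norm_ge0 q : 0 <= nquot_norm q.
Proof.
apply: lb_le_inf; last by move=> _ [w _ <-].
by exists `|repr q|, (repr q) => //=; rewrite reprK.
Qed.

Lemma nquot_normD p q : nquot_norm (p + q) <= nquot_norm p + nquot_norm q.
Proof.
apply/ler_addgt0Pr => e e0; have e20 : 0 < e / 2 by rewrite divr_gt0.
have [u <- ue] := nquot_norm_adherent p e20.
have [v <- ve] := nquot_norm_adherent q e20.
rewrite -nquot_piD (le_trans (nquot_norm_pi _))//.
rewrite (le_trans (ler_normD _ _))// [e]splitr addrACA.
by rewrite lerD// ltW.
Qed.

Lemma nquot_normZ (a : R) q : nquot_norm (a *: q) = `|a| * nquot_norm q.
Proof.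
have le (b : R) p : b != 0 -> nquot_norm (b *: p) <= `|b| * nquot_norm p.
  move=> b0; rewrite -ler_pdivrMl ?normr_gt0//; apply/ler_addgt0Pr => e e0.
  have [u <- ue] := nquot_norm_adherent p e0.
  rewrite ler_pdivrMl ?normr_gt0// [_ *: _]nquot_piZ.
  rewrite (le_trans (nquot_norm_pi _))// normrZ ler_pM2l ?normr_gt0//.
  exact: ltW.
have [->|a0] := eqVneq a 0.
  rewrite scale0r normr0 mul0r; apply/eqP.
  rewrite eq_le nquot_norm_ge0 andbT -(normr0 V).
  have -> : (0 : nquot) = \pi_nquot 0.
    by rewrite -[0 in RHS](scale0r (0 : V)) -nquot_piZ
    -[LHS](scale0r (\pi_nquot (0 : V))).
  exact: nquot_norm_pi.
apply/eqP; rewrite eq_le le//= -ler_pdivlMl ?normr_gt0// -normfV.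
have {1}-> : q = a^-1 *: (a *: q) by rewrite scalerA mulVf// scale1r.
by rewrite le// invr_eq0.
Qed.

Lemma nquot_norm0_eq0 q : nquot_norm q = 0 -> q = 0.
Proof.
elim/nquot_piW: q => v v0.
have -> : (0 : nquot) = \pi_nquot 0.
  by rewrite -[0 in RHS](scale0r (0 : V)) -nquot_piZ
    -[LHS](scale0r (\pi_nquot (0 : V))).
apply/nquotP; rewrite subr0; apply: (@subspace_closed V W) => B.
move=> /nbhs_ballP[e /= e0 eB].
have [w /nquotP Wwv we] := nquot_norm_adherent (\pi_nquot v) e0.
exists (v - w); split.
  rewrite -opprB; apply/set_mem; apply: (rpredNr (S := subspace_pred)).
  exact/mem_set.
apply: eB; rewrite -ball_normE /= opprB addrC subrK.
by rewrite v0 add0r in we.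
Qed.

HB.instance Definition _ := Lmodule_isNormed.Build R nquot
  nquot_normD nquot_normZ nquot_norm0_eq0.

Definition quotient_space : normedModType R := NormedModule.clone R nquot _.

End Quotient.

Definition isometric_automorphism {R : realType} {V : normedModType R}
    (T : {linear V -> V}) : Prop :=
  bijective T /\ forall x, `|T x| = `|x|.

Definition convex_hull {R : realType} {V : normedModType R} (A : set V) :
  set V := smallest (@convex_set R V) A.

(* The linear isometric bijections of V form the group G_V. *)
Definition convex_transitive {R : realType} (V : normedModType R) : Prop :=
  forall x : V, `|x| = 1 ->
    closure (convex_hull [set T x | T in @isometric_automorphism R V]) =
    [set y | `|y| <= 1].

Section SmallSupport.
Context {R : realType} {I : Type} {X : normedModType R}.
Implicit Types (K : cardinal) (Y : set X).

(* l^oo_K(I, X) *)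
Definition linf_supp_le K : set (linf_space I X) :=
  [set x | [set i | x i != 0] #<= [set: K]].

(* l^oo(I, Y), as a subset of l^oo(I, X) *)
Definition linf_valued_in Y : set (linf_space I X) :=
  [set x | forall i, Y (x i)].

(* l^oo_K(I, X) + l^oo(I, Y) *)
Definition supp_le_add K Y : set (linf_space I X) :=
  [set x + y | x in linf_supp_le K & y in linf_valued_in Y].

(* An equivalent form of supp_le_add, used only to prove that the sum is a
   closed subspace. *)
Definition almost_valued_in K Y : set (linf_space I X) :=
  [set x | [set i | ~ Y (x i)] #<= [set: K]].

Lemma linf_supp_leE K : linf_supp_le K = almost_valued_in K [set 0].
Proof.
apply/seteqP; split=> x; apply: card_le_trans; apply: subset_card_le => i /=.
  by move=> /eqP.
by move=> /eqP.
Qed.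

Definition linf_restr (x : linf_space I X) (A : set I) (i : I) : X :=
  if i \in A then x i else 0.

Lemma linf_restr_bounded x A : bounded_family (linf_restr x A).
Proof.
apply: bounded_familyP; exists `|x| => i; rewrite /linf_restr.
by case: ifP => _; rewrite ?normr0 ?linf_coord_le.
Qed.

Lemma supp_le_addE K Y : Y 0 -> supp_le_add K Y = almost_valued_in K Y.
Proof.
move=> Y0; apply/seteqP; split=> [_ [u uK [v vY <-]]|x xK].
  apply: card_le_trans uK; apply: subset_card_le => i; rewrite /mkset.
  apply: contra_notN => /eqP ui0; rewrite linfDE ui0 add0r; exact: vY.
pose A := [set i | ~ Y (x i)].
exists (linf_mk (linf_restr_bounded x A)).
  apply: card_le_trans xK; apply: subset_card_le => i /=; rewrite linf_mkE.
  by rewrite /linf_restr; case: ifPn => [/set_mem//|]; rewrite eqxx.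
exists (linf_mk (linf_restr_bounded x (~` A))) => [i|].
  by rewrite linf_mkE /linf_restr; case: ifPn => [/set_mem/contrapT//|_].
apply: linf_ext => i; rewrite linfDE !linf_mkE /linf_restr.
have [iA|iA] := pselect (A i).
  by rewrite (mem_set iA) (memNset (A := ~` A)) ?addr0//; exact.
by rewrite (memNset iA) (mem_set (A := ~` A)) ?add0r.
Qed.

Lemma almost_valued_in_submod K Y : uncountable_cofinality K ->
  submod_closed (mem Y) -> submod_closed (mem (almost_valued_in K Y)).
Proof.
move=> hK [/set_mem Y0 Ylin]; split.
  apply/mem_set; rewrite /almost_valued_in/= (_ : [set _ | _] = set0)//.
  by apply/seteqP; split=> // i; apply; rewrite linf0E.
move=> a x y /set_mem xK /set_mem yK; apply/mem_set.
apply: card_le_trans (uncof_setU hK xK yK); apply: subset_card_le => i.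
rewrite /mkset; apply: contra_notP => /not_orP[/contrapT xi /contrapT yi].
by rewrite linfDE linfZE; apply/set_mem/Ylin; exact/mem_set.
Qed.

Lemma almost_valued_in_closed K Y : uncountable_cofinality K ->
  closed Y -> closed (almost_valued_in K Y).
Proof.
move=> hK Yc x clx.
have [u uP] : {u : nat -> linf_space I X &
    forall n, almost_valued_in K Y (u n) /\ `|x - u n| < n.+1%:R^-1}.
  apply: (@choice _ _ (fun n v => almost_valued_in K Y v /\
    `|x - v| < n.+1%:R^-1)) => n.
  have [|v [? xv]] := clx (ball x n.+1%:R^-1).
    by apply: nbhsx_ballx; rewrite invr_gt0.
  by exists v; split=> //; rewrite -ball_normE in xv.
apply: card_le_trans (uncof_bigcup hK
  (F := fun n => [set i | ~ Y (u n i)]) (fun n => (uP n).1)).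
apply: subset_card_le => i; rewrite /mkset; apply: contra_notP => nu.
apply: Yc => B /nbhs_ballP[e /= e0 eB].
have [n ne] : exists n, n.+1%:R^-1 < e.
  by exists (Num.truncn e^-1); rewrite invf_plt ?posrE// truncnS_gt.
exists (u n i); split.
  by apply: contrapT => un; apply: nu; exists n.
apply: eB; rewrite -ball_normE /= -linfBE.
by rewrite (le_lt_trans (linf_coord_le _ _))// (lt_trans (uP n).2).
Qed.

End SmallSupport.
Arguments linf_supp_le {R} I X K.

Lemma set0_submod_closed {R : realType} (X : normedModType R) :
  submod_closed (mem [set (0 : X)]).
Proof.
split=> [|a u v /set_mem -> /set_mem ->]; apply/mem_set => //.
by rewrite /= scaler0 addr0.
Qed.

Definition real_space (R : realType) : normedModType R :=
  NormedModule.clone R R^o _.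

Section Ideal.
Context {R : realType}.
Variables (K I L J : cardinal).
Hypotheses (hK : uncountable_cofinality K) (hL : uncountable_cofinality L).

Lemma supp_le_submod_closed :
  submod_closed (mem (linf_supp_le J (real_space R) L)).
Proof.
rewrite linf_supp_leE; apply: almost_valued_in_submod => //.
exact: set0_submod_closed.
Qed.

Lemma supp_le_closed : closed (linf_supp_le J (real_space R) L).
Proof. by rewrite linf_supp_leE; apply: almost_valued_in_closed. Qed.

(* l^oo_K(I, l^oo(J)) + l^oo(I, l^oo_L(J)); here I = K^+ and J = L^+. *)
Definition quotient_ideal_set :
  set (linf_space I (linf_space J (real_space R))) :=
  supp_le_add K (linf_supp_le J (real_space R) L).

Lemma quotient_ideal_setE : quotient_ideal_set =
  almost_valued_in K (linf_supp_le J (real_space R) L).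
Proof. by apply: supp_le_addE; apply/set_mem; case: supp_le_submod_closed. Qed.

Lemma quotient_ideal_submod_closed : submod_closed (mem quotient_ideal_set).
Proof.
rewrite quotient_ideal_setE; apply: almost_valued_in_submod => //.
exact: supp_le_submod_closed.
Qed.

Lemma quotient_ideal_closed : closed quotient_ideal_set.
Proof.
rewrite quotient_ideal_setE; apply: almost_valued_in_closed => //.
exact: supp_le_closed.
Qed.

Definition quotient_ideal : closed_subspace _ :=
  ClosedSubspace quotient_ideal_submod_closed quotient_ideal_closed.

End Ideal.
Arguments quotient_ideal R {K} I {L} J hK hL.

(* Main.v *)
Require Import Defs.
From HB Require Import structures.
From mathcomp Require Import all_boot all_order all_algebra.
From mathcomp Require Import all_classical all_reals all_analysis.
From mathcomp Require Import wochoice generic_quotient.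
From mathcomp Require Import lra ring.

(* Write the elements of the algebra as bounded functions v(i,j).  If v has
   norm 1 in the quotient, then for every e > 0 there are kappa^+ many rows i in
   which |v(i,j)| > 1 - e for lambda^+ many j.  Hence a permutation of the rows,
   permutations inside each row and a change of signs, all of which preserve the
   ideal, carry v to a function e-close to any prescribed {-1,1}-valued t, except
   where c(i) = k or d(j) = k; here c and d are fixed maps to nat all of
   whose fibres have full cardinality.  Any u with |u| <= 1 is within 2/n of the
   mean of n such functions t_0, ..., t_(n-1); rearranging v towards t_k with
   exceptional set of index k, the exceptional sets spoil at most two of the n
   terms at each point, so the mean of the rearranged v is within e + 4/n
   of u. *)

Set Implicit Arguments.
Unset Strict Implicit.
Unset Printing Implicit Defensive.

Import Order.TTheory GRing.Theory Num.Theory.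
Import numFieldNormedType.Exports.

Local Open Scope classical_set_scope.
Local Open Scope ring_scope.
Local Open Scope card_scope.
Local Open Scope quotient_scope.

(** * Comparability of cardinalities and a Cantor-Bernstein bijection *)

Section Cardinality.

Lemma inj_card_le_sets {T U : Type} (A : set T) (B : set U) (f : T -> U) :
  (forall x, A x -> B (f x)) -> {in A &, injective f} -> A #<= B.
Proof.
move=> fAB /inj_card_eq; rewrite card_eq_le => /andP[_ /card_le_trans]; apply.
by apply: subset_card_le => _ [x Ax <-]; exact: fAB.
Qed.

Lemma card_le_sets_inj {T U : Type} (u0 : U) (A : set T) (B : set U) :
  A #<= B -> exists f : T -> U,
    (forall x, A x -> B (f x)) /\ {in A &, injective f}.
Proof.
pose U' : pointedType := HB.pack U (gen_eqMixin U) (gen_choiceMixin U)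
  (isPointed.Build U u0).
move=> /(@pcard_leP T U' A)[f]; exists f; split; last exact: inj.
by move=> x Ax; apply: (@funS _ _ _ _ f).
Qed.

(** By Zorn there is a maximal graph [G] of a partial bijection between [A] and [B]. If both sides
    had an unmatched point, pairing these two points would enlarge [G]. *)
Lemma card_le_total {T U : Type} (A : set T) (B : set U) :
  A #<= B \/ B #<= A.
Proof.
pose P (G : set (T * U)) := (forall p, G p -> A p.1 /\ B p.2) /\
  (forall p q, G p -> G q -> (p.1 = q.1 <-> p.2 = q.2)).
have [F FP Ftot|G [[GAB Ginj] Gmax]] := @Zorn_bigcup _ P.
  split=> [p [G FG Gp]|p q [G FG Gp] [H FH Hq]]; first exact: (FP _ FG).1.
  by have [GH|HG] := Ftot _ _ FG FH; [apply: (FP _ FH).2 => //; exact: GH|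
    apply: (FP _ FG).2 => //; exact: HG].
have [totA|/existsNP[a /not_implyP[Aa na]]] :=
    pselect (forall a, A a -> exists b, G (a, b)).
  left; have [[b0 _]|nB] := pselect (exists b : U, True); last first.
    suff -> : A = set0 by exact: card_ge0.
    by apply/seteqP; split=> // a /totA[b _]; apply: nB; exists b.
  have [f fP] : {f : T -> U & forall a, A a -> G (a, f a)}.
    apply: (@choice _ _ (fun a b => A a -> G (a, b))) => a.
    by have [/totA[b Gb]|nA] := pselect (A a); [exists b|exists b0].
  apply: (@inj_card_le_sets _ _ _ _ f) => [a /fP/GAB[]//|a a'].
  by move=> /set_mem/fP Ga /set_mem/fP Ga' e; apply/(Ginj _ _ Ga Ga').
have [totB|/existsNP[b /not_implyP[Bb nb]]] :=
    pselect (forall b, B b -> exists a, G (a, b)).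
  right; have [f fP] : {f : U -> T & forall b, B b -> G (f b, b)}.
    apply: (@choice _ _ (fun b a => B b -> G (a, b))) => b.
    by have [/totB[a' Ga]|nB] := pselect (B b); [exists a'|exists a].
  apply: (@inj_card_le_sets _ _ _ _ f) => [b /fP/GAB[]//|b b'].
  by move=> /set_mem/fP Gb /set_mem/fP Gb' e; apply/(Ginj _ _ Gb Gb').
exfalso; apply: (Gmax (G `|` [set (a, b)])).
  split=> [p Gp|sub]; first by left.
  by apply: na; exists b; apply: sub; right.
split=> [p [/GAB//|->//]|p q [Gp|->] [Gq|->]//=]; first exact: Ginj.
- split=> e; exfalso; [apply: na; exists p.2|apply: nb; exists p.1].
    by rewrite -e -surjective_pairing.
  by rewrite -e -surjective_pairing.
- split=> e; exfalso; [apply: na; exists q.2|apply: nb; exists q.1].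
    by rewrite e -surjective_pairing.
  by rewrite e -surjective_pairing.
Qed.

(* The Cantor-Bernstein bijection [h] built from [f] and [g] satisfies
   [h x = f x] or [x = g (h x)] at each [x]. *)
Lemma banach_mapping {T : Type} (A B : set T) (f g : T -> T) :
  injective f -> injective g -> (forall x, B (f x)) -> (forall x, A (g x)) ->
  exists h k : T -> T, [/\ cancel h k, cancel k h &
    forall x, ~ A x -> B (h x)].
Proof.
move=> fI gI fB gA.
(* [C] collects the forward orbits under [g \o f] of the points outside the range of [g]. The
   bijection follows [f] on [C] and the inverse of [g] off [C]; a point outside [A] is not in the
   range of [g], hence lies in [C]. *)
pose C := [set x | exists n z, (forall t, g t <> z) /\ iter n (g \o f) z = x].
have [g' g'P] : {g' : T -> T & forall x, ~ C x -> g (g' x) = x}.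
  apply: (@choice _ _ (fun x t => ~ C x -> g t = x)) => x.
  have [[t <-]|nt] := pselect (exists t, g t = x); first by exists t.
  exists x => -[]; exists 0%N, x; split=> // t gt; apply: nt; by exists t.
have Cgf x : C (g (f x)) <-> C x.
  split=> [[[|n] [z [nz]]]|[n [z [nz <-]]]]; last by exists n.+1, z.
    by move=> /= e; case: (nz (f x)).
  by move=> /= /gI/fI e; exists n, z.
have Cf y : C (g y) -> exists x, f x = y.
  move=> [[|n] [z [nz]]] /=; first by move=> e; case: (nz y).
  by move=> /gI <-; exists (iter n (g \o f) z).
have [k kP] : {k : T -> T & forall y,
    (C (g y) -> f (k y) = y) /\ (~ C (g y) -> k y = g y)}.
  apply: (@choice _ _ (fun y x => (C (g y) -> f x = y) /\
    (~ C (g y) -> x = g y))) => y.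
  have [/[dup] /Cf[x xy] Cy|nCy] := pselect (C (g y)); first by exists x.
  by exists (g y).
pose h x := if pselect (C x) then f x else g' x.
have hC x : C x -> h x = f x by rewrite /h; case: pselect.
have hnC x : ~ C x -> h x = g' x by rewrite /h; case: pselect.
exists h, k; split.
- move=> x; have [Cx|nCx] := pselect (C x).
    by rewrite hC//; apply: fI; apply: (kP _).1; exact/Cgf.
  by rewrite hnC// (kP _).2 g'P.
- move=> y; have [Cgy|nCgy] := pselect (C (g y)).
    by rewrite hC ?(kP _).1//; apply/Cgf; rewrite (kP _).1.
  by rewrite (kP _).2// hnC//; apply: gI; rewrite g'P.
- move=> x nAx; have [Cx|nCx] := pselect (C x); first by rewrite hC.
  by case: nAx; rewrite -(g'P _ nCx).
Qed.

End Cardinality.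

(** * Successor cardinals: large subsets, cofinality and partitions *)

Section Successor.

(** Needed because [is_successor] compares only with cardinals, not with arbitrary sets. If [A]
    embeds in no proper initial segment of itself, the induced order is already initial; otherwise
    the segment below the least [m] such that [A] embeds below [m] is initial. *)
Lemma cardinal_of_set (K : cardinal) (A : set K) :
  exists M : cardinal, [set: M] #<= A /\ A #<= [set: M].
Proof.
pose seg (B : set K) x := [set y | [/\ B y, cardinal_le y x & y <> x]].
have initial (B : set K) : (forall x, B x -> ~ (B #<= seg B x)) ->
    exists M : cardinal, [set: M] #<= B /\ B #<= [set: M].
  move=> Binit; pose S := {x : K | B x}.
  pose le : rel S := fun x y => cardinal_le (sval x) (sval y).
  have sval_inj (x y : S) : sval x = sval y -> x = y.
    case: x y => x Bx [y By] /= xy; rewrite xy in Bx *.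
    by rewrite (Prop_irrelevance Bx By).
  have le_wo : well_order le.
    move=> C [c cC].
    have [|_ [x Cx <-] xmin] := @cardinal_min K [set sval y | y in [set` C]].
      by exists (sval c), c.
    exists x; split=> [|y [yC ymin]].
      by split=> // y yC; apply: xmin; exists y.
    apply: sval_inj; apply: cardinal_le_anti; last exact: ymin.
    by apply: xmin; exists y.
  have SB : [set: S] #<= B.
    apply: (@inj_card_le_sets _ _ _ _ sval) => [[]//|x y _ _]; exact: sval_inj.
  have BS : B #<= [set: S].
    have [[b Bb]|nB] := pselect (exists b, B b); last first.
      suff -> : B = set0 by exact: card_ge0.
      by apply/seteqP; split=> // x Bx; apply: nB; exists x.
    pose f x := if pselect (B x) is left Bx then exist B x Bx else exist B b Bb.
    apply: (@inj_card_le_sets _ _ _ _ f) => // x y /set_mem Bx /set_mem By.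
    by rewrite /f; case: pselect => // ?; case: pselect => // ? [].
  have Sinit (x : S) : ~ ([set: S] #<= [set y | le y x /\ y <> x]).
    move=> Sx; apply: (Binit (sval x) (svalP x)).
    apply: card_le_trans (BS) _; apply: card_le_trans Sx _.
    apply: (@inj_card_le_sets _ _ _ _ sval) => [y [yx xy]|y z _ _].
      by split=> [|//|/sval_inj//]; exact: svalP.
    exact: sval_inj.
  by exists (Cardinal le_wo Sinit).
have [allA|/existsNP[a /not_implyP[Aa /contrapT As]]] :=
    pselect (forall x, A x -> ~ (A #<= seg A x)).
  exact: initial.
have [|m [Am Ams] mmin] := @cardinal_min K [set x | A x /\ A #<= seg A x].
  by exists a.
have [x [Bx xm neq] /(card_le_trans Ams) Bs|M [MB BM]] := initial (seg A m).
  have mx : cardinal_le m x.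
    apply: mmin; split=> //; apply: card_le_trans Bs _.
    by apply: subset_card_le => y [[]].
  by apply: neq; apply: cardinal_le_anti.
exists M; split; last exact: card_le_trans Ams BM.
by apply: card_le_trans MB _; apply: subset_card_le => y [].
Qed.

(** Comparability makes [A] strictly larger than [K], and the minimality of [Kp] applies to the
    cardinal equipotent to [A]. *)
Lemma successor_card_le (K Kp : cardinal) (A : set Kp) : is_successor K Kp ->
  ~ (A #<= [set: K]) -> [set: Kp] #<= A.
Proof.
move=> [_ Kpmin] nAK; have [//|KA] := card_le_total A [set: K].
have [M [MA AM]] := cardinal_of_set A; apply: card_le_trans _ MA.
apply: Kpmin; split; first exact: card_le_trans KA AM.
by move=> MK; apply: nAK; apply: card_le_trans AM MK.
Qed.

(** Each initial segment of [Kp] has size at most [K]. A countable cofinal set would make [Kp] a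
    countable union of such segments, hence no larger than [K]. *)
Lemma successor_uncountable_cofinality (K Kp : cardinal) :
  uncountable_cofinality K -> is_successor K Kp -> uncountable_cofinality Kp.
Proof.
move=> hK sK A Acof /countable_injP[e eI].
have [k0 _] := uncof_inhabited hK.
have seg x : [set y : Kp | cardinal_le y x] #<= [set: K].
  apply: (@card_le_trans _ _ _ ([set y | cardinal_le y x /\ y <> x] `|` [set x])).
    apply: subset_card_le => y /= yx.
    by have [->|] := pselect (y = x); [right|left].
  apply: uncof_setU => //.
    apply: contrapT => /(successor_card_le sK); exact: cardinal_initial.
  by apply: (@inj_card_le_sets _ _ _ _ (fun=> k0)) => // y z /set_mem -> /set_mem ->.
case: (sK) => -[_ nKp] _; apply: nKp.
pose F n := [set y : Kp | exists a, [/\ A a, e a = n & cardinal_le y a]].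
apply: card_le_trans (uncof_bigcup hK (F := F) _).
  apply: subset_card_le => y _; have [a Aa ya] := Acof y.
  by exists (e a) => //; exists a.
move=> n; have [[a [Aa an]]|na] := pselect (exists a, A a /\ e a = n).
  apply: card_le_trans (seg a); apply: subset_card_le => y [b [Ab bn yb]] /=.
  suff -> : a = b by [].
  by apply: eI; [exact/mem_set|exact/mem_set|rewrite an bn].
suff -> : F n = set0 by exact: card_ge0.
by apply/seteqP; split=> // y [a [Aa an _]]; apply: na; exists a.
Qed.

(** [c] reads the second coordinate through an injection of [K * nat] into [K]. Off its range [c] is
    0, which only enlarges one fibre. *)
Lemma uncof_partition (K : cardinal) : uncountable_cofinality K ->
  exists c : K -> nat, forall n, exists2 g : K -> K,
    injective g & forall x, c (g x) = n.
Proof.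
move=> hK; have [p pI] := uncof_prod_nat hK.
have [c cP] : {c : K -> nat & forall y x n, p (x, n) = y -> c y = n}.
  apply: (@choice _ _ (fun y m => forall x n, p (x, n) = y -> m = n)) => y.
  have [[[x n] <-]|ny] := pselect (exists xn, p xn = y).
    by exists n => x' n' /pI[].
  by exists 0%N => x n xy; case: ny; exists (x, n).
exists c => n; exists (fun x => p (x, n)) => [x y /pI[]//|x].
exact: cP.
Qed.

(** Mixes an injection of [Kp] into [A] with an injection into the fibre [c = n]. The result can
    leave [A] only on that fibre. It serves both for permuting rows and for permuting inside a
    row. *)
Lemma successor_bijection (K Kp : cardinal) (A : set Kp) (c : Kp -> nat) n :
  is_successor K Kp -> ~ (A #<= [set: K]) ->
  (exists2 g : Kp -> Kp, injective g & forall x, c (g x) = n) ->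
  exists h k : Kp -> Kp, [/\ cancel h k, cancel k h &
    forall x, c x <> n -> A (h x)].
Proof.
move=> sK /(successor_card_le sK) KpA [g gI gn].
have [[x0 _]|nKp] := pselect (exists x : Kp, True); last first.
  by exists id, id; split=> // x; case: nKp; exists x.
have [f [fA fI]] := card_le_sets_inj x0 KpA.
apply: (@banach_mapping _ [set x | c x = n] A f g) => // [x y|x].
  by apply: fI; rewrite in_setT.
exact: fA.
Qed.

End Successor.

(** * Means in convex hulls, and the easy inclusion for the orbit *)

Section ConvexHull.
Context {R : realType} {V : normedModType R}.
Implicit Types A : set V.

Lemma convex_hull_mean A (t : nat -> V) n : (forall k, A (t k)) ->
  convex_hull A (n.+1%:R^-1 *: \sum_(k < n.+1) t k).
Proof.
move=> At C [Cconv AC]; elim: n => [|n IHn].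
  by rewrite big_ord1 invr1 scale1r; exact: AC.
have n0 : 0 <= n.+1%:R / n.+2%:R :> R by rewrite divr_ge0.
have n1 : n.+1%:R / n.+2%:R <= 1 :> R.
  by rewrite ler_pdivrMr// mul1r ler_nat.
rewrite (_ : _ *: _ = n.+1%:R / n.+2%:R *: (n.+1%:R^-1 *: \sum_(k < n.+1) t k)
    + (1 - n.+1%:R / n.+2%:R) *: t n.+1).
  exact/set_mem/(Cconv _ _ (Itv01 n0 n1) (mem_set IHn) (mem_set (AC _ (At _)))).
rewrite big_ord_recr /= scalerDr scalerA; congr (_ *: _ + _ *: _).
  by rewrite mulrAC divff ?mul1r// pnatr_eq0.
apply: (@mulIf _ n.+2%:R); first by rewrite pnatr_eq0.
by rewrite mulrBl mul1r mulfVK ?pnatr_eq0// mulVf ?pnatr_eq0// -natrB// subSnn.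
Qed.

Lemma convex_closed_ball (r : R) : @convex_set R V [set y | `|y| <= r].
Proof.
move=> x y l /set_mem xr /set_mem yr; apply/mem_set => /=.
have l0 : 0 <= l%:num :> R by exact: ge0.
have l1 : 0 <= 1 - l%:num :> R by rewrite subr_ge0; exact: le1.
rewrite (le_trans (ler_normD _ _))// !normrZ !ger0_norm//.
rewrite (_ : r = l%:num * r + (1 - l%:num) * r); last by ring.
by apply: lerD; apply: ler_wpM2l.
Qed.

Lemma closed_norm_ball (r : R) : closed [set y : V | `|y| <= r].
Proof.
apply: (@preimage_closed _ _ (fun y : V => `|y|) [set s | s <= r]).
  by move=> y _; exact: norm_continuous.
exact: closed_le.
Qed.

Lemma closure_hull_orbit_sub (x : V) : `|x| <= 1 ->
  closure (convex_hull [set T x | T in @isometric_automorphism R V])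
  `<=` [set y | `|y| <= 1].
Proof.
move=> x1; rewrite closureE; apply: smallest_sub.
  exact: closed_norm_ball.
apply: smallest_sub; first exact: convex_closed_ball.
by move=> _ [T [_ Tiso] <-]; rewrite /= Tiso.
Qed.

End ConvexHull.

(** * Isometric automorphisms induced on a quotient *)

Section QuotientMap.
Context {R : realType} {V : normedModType R} (W : closed_subspace V).

Local Notation Q := (quotient_space W).

Lemma nquot_norm_pi_le (v : V) : `|\pi_Q v| <= `|v|.
Proof. exact: nquot_norm_pi. Qed.

(** Invariance of [W] makes the choice of [repr q] irrelevant. The norm bound passes to the quotient
    through representatives of nearly minimal norm. *)
Lemma quotient_map (f : V -> V) : linear f ->
  (forall v, subspace_set W v -> subspace_set W (f v)) -> (forall v, `|f v| <= `|v|) ->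
  exists T : {linear Q -> Q}, (forall v, T (\pi_Q v) = \pi_Q (f v)) /\
    forall q, `|T q| <= `|q|.
Proof.
move=> flin fW fcontr.
have fB u v : f (u - v) = f u - f v.
  by rewrite addrC -scaleN1r flin scaleN1r addrC.
pose T (q : Q) : Q := \pi_Q (f (repr q)).
have Tpi v : T (\pi_Q v) = \pi_Q (f v).
  by apply/nquotP; rewrite -fB; apply: fW; apply/nquotP; exact: reprK.
have Tlin : linear T.
  move=> a; elim/(@nquot_piW R V W) => u; elim/(@nquot_piW R V W) => v.
  have e (w z : V) : a *: \pi_Q w + \pi_Q z = \pi_Q (a *: w + z).
    by rewrite [RHS]nquot_piD -nquot_piZ.
  by rewrite (e u v) !Tpi flin e.
pose TL := GRing.isLinear.Build _ _ _ _ T Tlin.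
pose T' : {linear Q -> Q} := HB.pack T TL.
exists T'; split=> [|q]; first exact: Tpi.
apply/ler_addgt0Pr => e e0; have [v <- ve] := nquot_norm_adherent q e0.
rewrite [T' _]Tpi; apply: le_trans (nquot_norm_pi_le _) _.
exact: le_trans (fcontr v) (ltW ve).
Qed.

(** Both induced maps are contractions and they are mutually inverse, so neither can decrease a
    norm. *)
Lemma quotient_isometric_automorphism (f g : V -> V) : linear f -> linear g ->
  (forall v, subspace_set W v -> subspace_set W (f v)) ->
  (forall v, subspace_set W v -> subspace_set W (g v)) ->
  (forall v, `|f v| <= `|v|) -> (forall v, `|g v| <= `|v|) ->
  cancel f g -> cancel g f ->
  exists T : {linear Q -> Q}, isometric_automorphism T /\
    forall v, T (\pi_Q v) = \pi_Q (f v).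
Proof.
move=> flin glin fW gW fc gc fK gK.
have [T [Tpi Tc]] := quotient_map flin fW fc.
have [S [Spi Sc]] := quotient_map glin gW gc.
have TK : cancel T S by elim/(@nquot_piW R V W) => v; rewrite Tpi Spi fK.
have SK : cancel S T by elim/(@nquot_piW R V W) => v; rewrite Spi Tpi gK.
exists T; split=> //; split; first by exists S.
by move=> q; apply/eqP; rewrite eq_le Tc /= -{1}(TK q) Sc.
Qed.

Lemma quotient_pi_sum n (w : nat -> V) :
  \pi_Q (\sum_(k < n) w k) = \sum_(k < n) \pi_Q (w k).
Proof.
elim: n => [|n IHn]; last by rewrite !big_ord_recr /= nquot_piD IHn.
rewrite !big_ord0 -[0 in LHS](scale0r (0 : V)) -nquot_piZ.
exact: (scale0r (\pi_Q (0 : V))).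
Qed.

End QuotientMap.

(** * Bounded functions of two variables *)

Section DoubleFamilies.
Context {R : realType} {I J : Type}.

Local Notation V := (linf_space I (linf_space J (real_space R))).
Implicit Types v w : V.

Lemma linf2_ext v w : (forall i j, v i j = w i j) -> v = w.
Proof. by move=> vw; apply: linf_ext => i; apply: linf_ext => j. Qed.

Lemma linf2_coord_le v i j : `|v i j : R| <= `|v|.
Proof. exact: le_trans (linf_coord_le (v i) j) (linf_coord_le v i). Qed.

Lemma linf2_norm_le v M : 0 <= M -> (forall i j, `|v i j : R| <= M) -> `|v| <= M.
Proof.
by move=> M0 vM; apply: linf_norm_le => // i; exact: (linf_norm_le M0 (vM i)).
Qed.

Lemma linf2_exists (f : I -> J -> R) M : (forall i j, `|f i j| <= M) ->
  exists v : V, forall i j, v i j = f i j.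
Proof.
move=> fM.
have fb i : bounded_family (f i : J -> real_space R).
  by apply: bounded_familyP; exists M => j; exact: fM.
have vb : bounded_family (fun i => linf_mk (fb i) : linf_space J (real_space R)).
  apply: bounded_familyP; exists `|M| => i; apply: linf_norm_le => // j.
  by rewrite linf_mkE; apply: le_trans (fM i j) (ler_norm M).
by exists (linf_mk vb) => i j; rewrite !linf_mkE.
Qed.

Lemma linf2_sum n (w : nat -> V) i j :
  (\sum_(k < n) w k) i j = \sum_(k < n) w k i j.
Proof.
elim: n => [|n IHn]; first by rewrite !big_ord0 !linf0E.
by rewrite !big_ord_recr /= !linfDE IHn.
Qed.

(** Row permutations, permutations inside rows and sign changes all have this form. *)
Lemma weighted_composition (s : I -> J -> R) (a : I -> I) (b : I -> J -> J) :
  (forall i j, `|s i j| <= 1) -> exists f : V -> V,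
  [/\ forall v i j, f v i j = s i j * v (a i) (b i j),
      linear f & forall v, `|f v| <= `|v| ].
Proof.
move=> s1.
have sv v i j : `|s i j * v (a i) (b i j)| <= `|v|.
  rewrite normrM -[leRHS]mul1r ler_pM//; exact: linf2_coord_le.
have [f fE] := choice (fun v => linf2_exists (sv v)).
exists f; split=> // [c v w|v].
  apply: linf2_ext => i j; rewrite !(linfDE, linfZE) !fE !(linfDE, linfZE).
  by rewrite mulrDr; congr (_ + _); rewrite mulrCA.
by apply: linf2_norm_le => // i j; rewrite fE.
Qed.

End DoubleFamilies.

(** * Signed rearrangements and large values modulo the ideal *)

Section TwistedQuotient.
Context {R : realType} {K I L J : cardinal}.
Hypotheses (hK : uncountable_cofinality K) (hL : uncountable_cofinality L).

Local Notation V := (linf_space I (linf_space J (real_space R))).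
Local Notation W := (quotient_ideal R I J hK hL).
Local Notation Q := (quotient_space W).

Lemma quotient_idealP (v : V) : subspace_set W v <->
  [set i | ~ ([set j | v i j != 0] #<= [set: L])] #<= [set: K].
Proof. by rewrite [subspace_set W]quotient_ideal_setE. Qed.

(** [a] injects the rows of [w] with large support into those of [v], and [b i] injects the support
    of row [i] of [w] into that of row [a i] of [v]. *)
Lemma ideal_weighted_composition (s : I -> J -> R) (a : I -> I) (b : I -> J -> J)
    (v w : V) :
  injective a -> (forall i, injective (b i)) ->
  (forall i j, w i j = s i j * v (a i) (b i j)) ->
  subspace_set W v -> subspace_set W w.
Proof.
move=> aI bI wE /quotient_idealP vW; apply/quotient_idealP.
apply: card_le_trans vW; apply: (@inj_card_le_sets _ _ _ _ a) => [i|i i' _ _].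
  apply: contra_not => vL; apply: card_le_trans vL.
  apply: (@inj_card_le_sets _ _ _ _ (b i)) => [j|j j' _ _]; last exact: bI.
  by rewrite /mkset wE mulf_eq0 => /norP[].
exact: aI.
Qed.

Lemma signed_rearrangement (s : I -> J -> R) (a a' : I -> I)
    (b b' : I -> J -> J) :
  (forall i j, s i j * s i j = 1) -> cancel a a' -> cancel a' a ->
  (forall i, cancel (b i) (b' i)) -> (forall i, cancel (b' i) (b i)) ->
  exists T : {linear Q -> Q}, isometric_automorphism T /\
    forall v : V, exists w : V, T (\pi_Q v) = \pi_Q w /\
      forall i j, w i j = s i j * v (a i) (b i j).
Proof.
move=> ss aK a'K bK b'K.
have s1 i j : `|s i j| <= 1.
  by rewrite -(@expr_le1 _ 2)// -normrX expr2 ss normr1.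
have [f [fE flin fc]] := weighted_composition a b s1.
(* The inverse moves entries back with the weight read at the original position; it cancels because
   each weight squares to 1. *)
have [g [gE glin gc]] := weighted_composition (s := fun i j => s (a' i) (b' (a' i) j))
  a' (fun i => b' (a' i)) (fun i j => s1 _ _).
have [||||T [Tiso Tpi]] := @quotient_isometric_automorphism _ _ W f g
    flin glin _ _ fc gc.
- move=> v; apply: (ideal_weighted_composition _ _ (fE v)).
    exact: can_inj aK.
  by move=> i; exact: can_inj (bK i).
- move=> v; apply: (ideal_weighted_composition _ _ (gE v)).
    exact: can_inj a'K.
  by move=> i; exact: can_inj (b'K _).
- by move=> v; apply: linf2_ext => i j; rewrite gE fE b'K a'K mulrA ss mul1r.
- by move=> v; apply: linf2_ext => i j; rewrite fE gE aK bK mulrA ss mul1r.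
by exists T; split=> // v; exists (f v); split.
Qed.

(** Otherwise setting [v] to 0 wherever its modulus exceeds [r] would change it only by an element
    of the ideal, leaving a representative of norm at most [r]. *)
Lemma quotient_norm_large (v : V) r : 0 <= r -> r < `|\pi_Q v| ->
  ~ ([set i | ~ ([set j | r < `|v i j : R|] #<= [set: L])] #<= [set: K]).
Proof.
move=> r0 rv vr.
have [|w wE] := @linf2_exists R I J
    (fun i j => if r < `|v i j : R| then 0 else v i j) r.
  by move=> i j; case: ifPn => [|]; rewrite ?normr0// -leNgt.
suff vw : \pi_Q v = \pi_Q w.
  move: rv; rewrite vw ltNge => /negP; apply.
  apply: le_trans (nquot_norm_pi_le _ _) _; apply: linf2_norm_le => // i j.
  by rewrite wE; case: ifPn => [|]; rewrite ?normr0// -leNgt.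
apply/nquotP/quotient_idealP; apply: card_le_trans vr.
apply: subset_card_le => i; apply: contra_not => /=; apply: card_le_trans.
apply: subset_card_le => j; rewrite /mkset !linfBE wE.
by case: ifPn => //; rewrite subrr eqxx.
Qed.

End TwistedQuotient.

(** * Approximating a real by means of signs *)

Section SigmaDelta.
Context {R : realType}.
Implicit Types u r : R.

(** A sign with value 1 at 0, so that it always squares to 1. *)
Definition pm1 r : R := if 0 <= r then 1 else -1.

Lemma pm1_sqr r : pm1 r * pm1 r = 1.
Proof. by rewrite /pm1; case: ifP => _; rewrite ?mulrNN mulr1. Qed.

Lemma pm1_mul r : pm1 r * r = `|r|.
Proof.
rewrite /pm1; case: ifPn => [r0|]; first by rewrite mul1r ger0_norm.
by rewrite -ltNge => r0; rewrite mulN1r ltr0_norm.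
Qed.

(* Sigma-delta modulation: the next sign is that of the accumulated error. *)
Fixpoint modulation_error u n : R :=
  if n is m.+1 then modulation_error u m + u - pm1 (modulation_error u m) else 0.

(** The increment, [u] minus the sign of the error, has modulus at most 2 and never points away from
    0, so the bound 2 persists. *)
Lemma modulation_error_le u n : `|u| <= 1 -> `|modulation_error u n| <= 2.
Proof.
rewrite ler_norml => /andP[u0 u1]; elim: n => [|n]/=; first by rewrite normr0.
rewrite !ler_norml => /andP[e0 e1]; rewrite /pm1.
by case: (leP 0 (modulation_error u n)) => e; apply/andP; split; lra.
Qed.

(** The increments of the error telescope. With the bound above, the mean of the first n signs is
    within 2/n of [u]. *)
Lemma modulation_sum u n :
  \sum_(k < n) pm1 (modulation_error u k) = n%:R * u - modulation_error u n.
Proof.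
elim: n => [|n IHn]; first by rewrite big_ord0 mul0r subrr.
by rewrite big_ord_recr /= IHn -natr1; ring.
Qed.

End SigmaDelta.

Lemma sum_indicator_le1 {R : realType} (c n : nat) :
  \sum_(k < n) (if c == k then 1 else 0 : R) <= 1.
Proof.
suff -> : \sum_(k < n) (if c == k then 1 else 0 : R) =
    if (c < n)%N then 1 else 0 by case: ifP.
elim: n => [|n IHn]; first by rewrite big_ord0.
rewrite big_ord_recr /= IHn ltnS (leq_eqVlt c).
by case: (ltngtP c n); rewrite ?addr0 ?add0r.
Qed.

(** * Approximating the unit ball by the hull of an orbit *)

Section ConvexTransitivity.
Context {R : realType} {K I L J : cardinal}.
Hypotheses (hK : uncountable_cofinality K) (hL : uncountable_cofinality L).
Hypotheses (sK : is_successor K I) (sL : is_successor L J).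

Local Notation V := (linf_space I (linf_space J (real_space R))).
Local Notation W := (quotient_ideal R I J hK hL).
Local Notation Q := (quotient_space W).

(* The rearrangement pulls the set where [|v|] is large back onto the complement
   of [c = n] times [d = n]; since these fibres are disjoint for distinct [n],
   each point is exceptional for at most two values of [n]. *)
Lemma rearrangement_near_signs (c : I -> nat) (d : J -> nat) (v : V) (e : R)
    (t : I -> J -> R) n :
  (exists2 g : I -> I, injective g & forall i, c (g i) = n) ->
  (exists2 g : J -> J, injective g & forall j, d (g j) = n) ->
  0 <= e -> e <= 1 -> (forall i j, t i j * t i j = 1) ->
  `|v| <= 1 + e ->
  ~ ([set i | ~ ([set j | 1 - e < `|v i j : R|] #<= [set: L])] #<= [set: K]) ->
  exists (T : {linear Q -> Q}) (w : V),
    [/\ isometric_automorphism T, T (\pi_Q v) = \pi_Q w &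
      forall i j, `|w i j - t i j : R| <=
        e + (if c i == n then 1 else 0) + (if d j == n then 1 else 0)].
Proof.
move=> cn dn e0 e1 tt ve vbig.
have [a [a' [aK a'K abig]]] := successor_bijection sK vbig cn.
have [b bP] : {b : I -> (J -> J) * (J -> J) & forall i,
    [/\ cancel (b i).1 (b i).2, cancel (b i).2 (b i).1 & c i <> n ->
      forall j, d j <> n -> 1 - e < `|v (a i) ((b i).1 j) : R|]}.
  apply: (@choice _ _ (fun i bb => [/\ cancel bb.1 bb.2, cancel bb.2 bb.1 &
    c i <> n -> forall j, d j <> n -> 1 - e < `|v (a i) (bb.1 j) : R|])) => i.
  (* An exceptional row carries no requirement, so the identity is used there. *)
  have [cin|/abig Abig] := pselect (c i = n); first by exists (id, id).
  have [h [k [hk kh hbig]]] := successor_bijection sL Abig dn.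
  by exists (h, k).
(* With this sign the rearranged entry is [t i j] times the modulus of the entry of [v], so only
   that modulus has to be compared with 1. *)
pose s i j := t i j * pm1 (v (a i) ((b i).1 j)).
have [i j|i|i|T [Tiso Tw]] := @signed_rearrangement R K I L J hK hL s
    a a' (fun i => (b i).1) (fun i => (b i).2) _ aK a'K.
- by rewrite /s mulrACA tt pm1_sqr mulr1.
- by case: (bP i).
- by case: (bP i).
have [w [Tvw wE]] := Tw v.
exists T, w; split=> // i j.
pose r : R := v (a i) ((b i).1 j).
have t1 : `|t i j| = 1.
  by apply/eqP; rewrite -(@pexpr_eq1 _ _ 2)// -normrX expr2 tt normr1.
rewrite wE /s -/r -mulrA pm1_mul -[X in _ - X]mulr1 -mulrBr normrM t1 mul1r.
have r2 : `|r| <= 1 + e by apply: le_trans (linf2_coord_le v _ _) ve.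
(* At exceptional points this crude bound is all there is; an indicator in the conclusion absorbs
   it. *)
have r1 : `| `|r| - 1| <= 1.
  by rewrite ler_norml; apply/andP; split; have := normr_ge0 r; lra.
case: eqP => [_|cin]; first by case: ifP => _; lra.
case: eqP => [_|djn]; first by lra.
have [_ _ /(_ cin j djn)] := bP i; rewrite -/r => rbig.
by rewrite !addr0 ler_norml; apply/andP; split; lra.
Qed.

Lemma hull_approximation (v u : V) (e : R) n : 0 <= e -> e <= 1 ->
  `|v| <= 1 + e -> `|u| <= 1 ->
  ~ ([set i | ~ ([set j | 1 - e < `|v i j : R|] #<= [set: L])] #<= [set: K]) ->
  exists2 z : Q,
    convex_hull [set T (\pi_Q v) | T in @isometric_automorphism R Q] z &
    `|\pi_Q u - z| <= e + 4 / n.+1%:R.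
Proof.
move=> e0 e1 ve u1 vbig.
have [c cP] := uncof_partition (successor_uncountable_cofinality hK sK).
have [d dP] := uncof_partition (successor_uncountable_cofinality hL sL).
(* The k-th target is the k-th sigma-delta sign of each entry of [u]; it is paired with the
   exceptional fibres of index k. *)
pose t k i j : R := pm1 (modulation_error (u i j : R) k).
have tt k i j : t k i j * t k i j = 1 by exact: pm1_sqr.
have [T TP] := choice (fun k => rearrangement_near_signs (cP k) (dP k) e0 e1
  (tt k) ve vbig).
have [w wP] := choice TP.
pose z : V := n.+1%:R^-1 *: \sum_(k < n.+1) w k.
exists (\pi_Q z).
  rewrite -[\pi_Q z](nquot_piZ W) quotient_pi_sum.
  apply: (@convex_hull_mean R Q _ (fun k => \pi_Q (w k))) => k.
  by have [Tiso Tw _] := wP k; exists (T k).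
have -> : \pi_Q u - \pi_Q z = \pi_Q (u - z).
  by apply/eqP; rewrite subr_eq -[X in _ == X]nquot_piD subrK.
apply: le_trans (nquot_norm_pi_le _ _) _.
apply: linf2_norm_le => [|i j]; first by rewrite addr_ge0// divr_ge0.
have n0 : 0 < n.+1%:R :> R by rewrite ltr0n.
rewrite !linfBE !linfZE linf2_sum.
(* The constant 4 is 2 from the modulation error plus 1 from each of the two families of exceptional
   fibres. *)
have -> : u i j - n.+1%:R^-1 *: \sum_(k < n.+1) w k i j =
    n.+1%:R^-1 * (modulation_error (u i j : R) n.+1
      - \sum_(k < n.+1) (w k i j - t k i j)) :> R.
  rewrite sumrB modulation_sum; apply: (mulfI (lt0r_neq0 n0)).
  rewrite mulrBr [_ *: _]/(_ * _) !mulVKf ?lt0r_neq0//; ring.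
rewrite normrM ger0_norm ?invr_ge0 ?ler0n// mulrC ler_pdivrMr//.
rewrite mulrDl divfK ?lt0r_neq0//.
apply: le_trans (ler_normB _ _) _.
have uij : `|u i j : R| <= 1 by apply: le_trans u1; exact: linf2_coord_le.
have := modulation_error_le n.+1 uij.
suff : `|\sum_(k < n.+1) (w k i j - t k i j) : R| <= e * n.+1%:R + 2 by lra.
apply: le_trans (ler_norm_sum _ _ _) _.
apply: (@le_trans _ _ (\sum_(k < n.+1)
    (e + (if c i == k then 1 else 0) + (if d j == k then 1 else 0)))).
  by apply: ler_sum => k _; have [_ _ ] := wP k; exact.
rewrite !big_split /= sumr_const card_ord -mulr_natr.
have := @sum_indicator_le1 R (c i) n.+1.
have := @sum_indicator_le1 R (d j) n.+1.
by lra.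
Qed.

Lemma quotient_convex_transitive : convex_transitive Q.
Proof.
move=> x x1; apply/seteqP; split.
  by apply: closure_hull_orbit_sub; rewrite x1.
move=> y /= y1 B /nbhs_ballP[r /= r0 rB].
(* Three errors of size at most [e] will add up: rescaling [u], the moduli of [v], and averaging.
   Their total is below [r]. *)
pose e := Num.min 1 (r / 4).
have e0 : 0 < e by rewrite lt_min ltr01 divr_gt0.
have e1 : e <= 1 by rewrite ge_min lexx.
have er : e <= r / 4 by rewrite ge_min lexx orbT.
have [v vx vlt] := nquot_norm_adherent x e0.
have [u uy ult] := nquot_norm_adherent y e0.
have ve : `|v| <= 1 + e by rewrite ltW// -x1.
have ue : `|u| <= 1 + e.
  by apply: le_trans (ltW ult) _; rewrite lerD2r.
have vbig : ~ ([set i | ~ ([set j | 1 - e < `|v i j : R|] #<= [set: L])]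
    #<= [set: K]).
  apply: (quotient_norm_large (hK := hK) (hL := hL) (r := 1 - e) _ _).
    by rewrite subr_ge0.
  by rewrite [X in `|X|]vx x1; lra.
(* The representative [u] may have norm slightly above 1; rescaling it into the unit ball costs at
   most [e]. *)
pose u' : V := (1 + e)^-1 *: u.
have e10 : 0 < 1 + e by lra.
have u'1 : `|u'| <= 1.
  by rewrite normrZ gtr0_norm ?invr_gt0// mulrC ler_pdivrMr// mul1r.
have uu' : `|u - u'| <= e.
  rewrite (_ : u - u' = e *: u'); last first.
    rewrite scalerA -[in LHS](scale1r u) -scalerBl; congr (_ *: _).
    by field; exact: lt0r_neq0.
  by rewrite normrZ gtr0_norm// -[leRHS]mulr1 ler_wpM2l// ltW.
have [n ne] : exists n, 4 / n.+1%:R <= e.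
  exists (Num.truncn (4 / e)); rewrite ler_pdivrMr ?ltr0n// mulrC.
  by rewrite -ler_pdivrMr// ltW// truncnS_gt.
have [z zhull zu] := hull_approximation n (ltW e0) e1 ve u'1 vbig.
exists z; split; first by rewrite -vx.
apply: rB; rewrite -ball_normE /= -uy.
have -> : \pi_Q u - z = \pi_Q (u - u') + (\pi_Q u' - z).
  by rewrite addrA -nquot_piD subrK.
apply: le_lt_trans (ler_normD _ _) _.
apply: le_lt_trans (lerD (le_trans (nquot_norm_pi_le W _) uu') zu) _.
apply: le_lt_trans (lerD (lexx e) (lerD (lexx e) ne)) _.
by lra.
Qed.

End ConvexTransitivity.

Theorem theorem3p2 (R : realType) (kappa kappa_plus lambda lambda_plus : cardinal)
  (hkappa : uncountable_cofinality kappa)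
  (hlambda : uncountable_cofinality lambda)
  (hkappa_plus : is_successor kappa kappa_plus)
  (hlambda_plus : is_successor lambda lambda_plus) :
  convex_transitive
    (quotient_space
       (quotient_ideal R kappa_plus lambda_plus hkappa hlambda)).
Proof. exact: quotient_convex_transitive. Qed.
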